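(* In the hyperbolic plane with absolute conic $\mathcal{N}\colon x_1^2+x_2^2-x_0^2=0$, let $$\mathcal{C}\colon b x_1^2 + a x_2^2 = x_0^2$$ be a general conic, with non-zero real numbers $a$, $b$ that are not both negative and not both equal to $1$ (this also comprises circles, for $a=1$, $b\neq 1$ or $b=1$, $a\neq 1$). Its Frégier conic has the equation $$\mathcal{F}\colon \frac{(a^2b^2-a^2-b^2)^2}{(a^2b^2+a^2-b^2)^2a^2}\,x_1^2 + \frac{(a^2b^2-a^2-b^2)^2}{(a^2b^2-a^2+b^2)^2b^2}\,x_2^2 = x_0^2.$$ It is singular if and only if $$b^2=\frac{a^2}{a^2+1},\qquad b^2=\frac{-a^2}{a^2-1},\qquad\text{or}\qquad b^2=\frac{a^2}{a^2-1}.$$ The Frégier locus is then, in that order, a projective line segment on the first axis ($x_2=0$), the second axis ($x_1=0$) or the third axis ($x_0=0$) of the underlying projective coordinate frame.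
   Context: Points have homogeneous coordinates $[x_0,x_1,x_2]$; points inside and outside the absolute conic $\mathcal{N}$ are treated equally (universal hyperbolic geometry). Two lines are orthogonal if they are conjugate with respect to $\mathcal{N}$. A circle is a conic having double contact with $\mathcal{N}$. For a regular conic $\mathcal{C}$ and $p\in\mathcal{C}$, the Frégier point $f(\mathcal{C},p)$ is the point common to the hypotenuses of all right triangles inscribed into $\mathcal{C}$ with right angle at $p$; equivalently, it is the pole with respect to $\mathcal{C}$ of the line $i\vee\overline{i}$, where $i$ and $\overline{i}$ are the projections of $p$ onto $\mathcal{C}$ via the isotropic lines through $p$ (the possibly complex tangents of $\mathcal{N}$ through $p$). The Frégier locus of $\mathcal{C}$ is $\mathcal{F}=\{f(\mathcal{C},p)\mid p\in\mathcal{C}\}$; if it is a conic it is called the Frégier conic of $\mathcal{C}$, and it is called singular if it is not a regular conic. A projective line segment is a segment (part) of a projective line.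
   Formalization: In F and the singularity conditions a² and b² are read as 1/b and 1/a (the printed claim fails at a=1, b=2); F is asserted for nonzero denominators, as containing the locus and equal to it when the locus is a conic; a segment may be the whole line. *)

(* Defs.v *)
From HB Require Import structures.
From mathcomp Require Import all_boot all_order all_algebra.
From mathcomp Require Import complex.
From mathcomp Require Import boolp classical_sets reals.

Set Implicit Arguments.
Unset Strict Implicit.
Unset Printing Implicit Defensive.

Import Order.TTheory GRing.Theory Num.Theory.
Local Open Scope ring_scope.
Local Open Scope classical_set_scope.

(* A point (resp. a line) of the projective plane over F is a nonzero row
   vector of homogeneous (resp. line) coordinates, up to proportionality.
   Loci are sets of nonzero vectors. *)
Section Projective.
Variable F : fieldType.
Implicit Types (x y p q r l m h f g : 'rV[F]_3) (M N : 'M[F]_3).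

Definition same_elt x y : bool := (x == y)%MS.

Definition incident x l : bool := x *m l^T == 0.

Definition on_conic M x : bool := x *m M *m x^T == 0.

Definition conic_set M : set 'rV[F]_3 := [set x | x != 0 /\ on_conic M x].

(* For p on a regular conic M this is the tangent at p. *)
Definition polar M p : 'rV[F]_3 := p *m M.

(* Conjugate lines: the pole of l with respect to N is incident with m. *)
Definition orthogonal N l m : bool := incident (l *m invmx N) m.

(* The conic c1 x1^2 + c2 x2^2 = x0^2. *)
Definition axis_conic (c1 c2 : F) : 'M[F]_3 :=
  diag_mx (\row_(i < 3) [:: -1; c1; c2]`_i).

Definition is_conic (S : set 'rV[F]_3) : Prop :=
  exists M, [/\ M^T = M, M != 0 & S = conic_set M].

Definition is_regular_conic (S : set 'rV[F]_3) : Prop :=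
  exists M, [/\ M^T = M, M \in unitmx & S = conic_set M].

Definition is_singular (S : set 'rV[F]_3) : Prop := ~ is_regular_conic S.

(* The line l through the point p of M meets M in p and q, counted with
   multiplicity: q = p means that l is the tangent at p. *)
Definition secant M p l q : Prop :=
  [/\ l != 0, q != 0, incident p l, incident q l & on_conic M q] /\
  (same_elt p q -> same_elt l (polar M p)).

(* f lies on the hypotenuses q r of all triangles p q r inscribed into M whose
   sides p q = l and p r = m are orthogonal. The multiplicity convention of
   [secant] admits the limiting triangles with a side tangent at p; this only
   matters when M touches N at p, where there are no others. *)
Definition on_hypotenuses N M p f : Prop :=
  f != 0 /\
  forall l m q r, secant M p l q -> secant M p m r -> orthogonal N l m ->
    ~~ same_elt q r ->
    forall h, h != 0 -> incident q h -> incident r h -> incident f h.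

Definition is_fregier_point N M p f : Prop :=
  on_hypotenuses N M p f /\
  forall g, on_hypotenuses N M p g -> same_elt g f.

Definition fregier_locus N M : set 'rV[F]_3 :=
  [set f | exists2 p, p \in conic_set M & is_fregier_point N M p f].

Definition touch M N p : Prop :=
  [/\ p != 0, on_conic M p, on_conic N p & same_elt (polar M p) (polar N p)].

Definition double_contact M N : Prop :=
  exists p q, [/\ ~~ same_elt p q, touch M N p & touch M N q].

End Projective.

Section Real.
Variable R : realType.
Implicit Types (u v x l : 'rV[R]_3) (N M : 'M[R]_3).

(* The points of contact may be complex. *)
Definition is_circle N M : Prop :=
  [/\ M^T = M, M \in unitmx, forall k : R, M <> k *: N &
      double_contact (map_mx (real_complex R) M) (map_mx (real_complex R) N)].

(* A part of the line l: either one of the two closed segments bounded by two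
   distinct points u and v of l (replacing v by -v gives the other one), or the
   whole line. *)
Definition projective_segment l (S : set 'rV[R]_3) : Prop :=
  S = [set x | x != 0 /\ incident x l] \/
  exists u v, [/\ u != 0, v != 0, ~~ same_elt u v, incident u l & incident v l]
    /\ S = [set x | x != 0 /\
             exists s t : R, [/\ 0 <= s, 0 <= t & same_elt x (s *: u + t *: v)]].

(* The line x_i = 0. *)
Definition axis_line (i : 'I_3) : 'rV[R]_3 := delta_mx 0 i.

End Real.

(* Main.v *)
Require Import Defs.
From mathcomp Require Import all_boot all_order all_algebra.
From mathcomp Require Import complex zify ring lra.
From mathcomp Require Import boolp classical_sets reals.

(** The Fregier point of p on a conic M is p T with T = 2 M N^-1 - tr(M N^-1).
    Indeed, for a triangle pqr inscribed into M, the Gram matrix G of M in the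
    basis p, q, r has zero diagonal; if H is the matrix of the dual form N^-1 in
    the dual basis, the p-coordinate of p T is
    2 (G H)_pp - tr(G H) = - 2 G_qr H_qr. It vanishes, so that p T lies on qr,
    because H_qr = 0 says that pq and pr are orthogonal.

    For the two diagonal conics of the theorem T is diagonal with entries
    1 - a - b, b - a - 1, a - b - 1, at most one of which is zero. If none is, T
    maps C onto a regular conic; if the i-th is, the image of C is the part of the
    line x_i = 0 cut out by a binary quadratic inequality, and a conic containing
    three points of a line contains the line. *)

Set Implicit Arguments.
Unset Strict Implicit.
Unset Printing Implicit Defensive.

Import Order.TTheory GRing.Theory Num.Theory.
Local Open Scope ring_scope.
Local Open Scope classical_set_scope.

(** * Dot and cross products of coordinate vectors *)

Lemma sum_ord3 (V : nmodType) (E : 'I_3 -> V) : \sum_i E i = E 0 + E 1 + E 2.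
Proof.
by rewrite !big_ord_recr big_ord0 /= add0r;
  congr (E _ + E _ + E _); apply: val_inj.
Qed.

Section Field.
Variable F : fieldType.
Implicit Types (u v w x y p q r l m h f g : 'rV[F]_3) (M N : 'M[F]_3) (k : F).

Lemma same_eltP x y :
  reflect (exists2 k, k != 0 & x = k *: y) (same_elt x y).
Proof.
apply: (iffP idP) => [/andP[/sub_rVP[k xE] /sub_rVP[j yE]]|[k k0 ->]].
  have [k0|k0] := eqVneq k 0; last by exists k.
  by exists 1; rewrite ?oner_eq0// yE xE k0 !(scale0r, scaler0).
by rewrite /same_elt; apply/andP; split; rewrite (eqmx_scale _ k0) submx_refl.
Qed.

Lemma same_elt_sym x y : same_elt x y = same_elt y x.
Proof. by rewrite /same_elt andbC. Qed.

Definition dot u v : F := (u *m v^T) 0 0.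

Lemma dot_mx u v : u *m v^T = (dot u v)%:M.
Proof. exact: mx11_scalar. Qed.

Lemma dotE u v : dot u v = u 0 0 * v 0 0 + u 0 1 * v 0 1 + u 0 2 * v 0 2.
Proof. by rewrite /dot !mxE sum_ord3 !mxE. Qed.

Lemma mulmx_tr_dot n1 n2 (A : 'M[F]_(n1, 3)) (B : 'M[F]_(n2, 3)) i j :
  (A *m B^T) i j = dot (row i A) (row j B).
Proof. by rewrite /dot !mxE; apply: eq_bigr => k _; rewrite !mxE. Qed.

Lemma mulmx3E n1 n2 (A : 'M[F]_(n1, 3)) (B : 'M[F]_(3, n2)) i j :
  (A *m B) i j = A i 0 * B 0 j + A i 1 * B 1 j + A i 2 * B 2 j.
Proof. by rewrite mxE sum_ord3. Qed.

Lemma dotC u v : dot u v = dot v u.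
Proof. by rewrite !dotE; ring. Qed.

Lemma dotDl u v w : dot (u + v) w = dot u w + dot v w.
Proof. by rewrite !dotE !mxE; ring. Qed.

Lemma dotZl k u w : dot (k *: u) w = k * dot u w.
Proof. by rewrite !dotE !mxE; ring. Qed.

Lemma dotDr u v w : dot w (u + v) = dot w u + dot w v.
Proof. by rewrite !dotE !mxE; ring. Qed.

Lemma dotZr k u w : dot w (k *: u) = k * dot w u.
Proof. by rewrite !dotE !mxE; ring. Qed.

Lemma dot_mulmx M u v : dot (u *m M) v = dot u (v *m M^T).
Proof. by rewrite /dot trmx_mul trmxK mulmxA. Qed.

Lemma dot_sym M u v : M^T = M -> dot (u *m M) v = dot (v *m M) u.
Proof. by move=> sM; rewrite dot_mulmx sM dotC. Qed.

Lemma incidentE x l : incident x l = (dot x l == 0).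
Proof.
rewrite /incident dot_mx; apply/eqP/eqP => [/matrixP/(_ 0 0)|->].
  by rewrite !mxE.
exact: raddf0.
Qed.

Lemma on_conicE M x : on_conic M x = (dot (x *m M) x == 0).
Proof. by rewrite -incidentE. Qed.

Lemma orthogonalE N l m : Defs.orthogonal N l m = (dot (l *m invmx N) m == 0).
Proof. by rewrite -incidentE. Qed.

Lemma rV3_eq u v : u 0 0 = v 0 0 -> u 0 1 = v 0 1 -> u 0 2 = v 0 2 -> u = v.
Proof.
move=> e0 e1 e2; apply/rowP; case=> [[|[|[|//]]] i3].
- by rewrite (_ : Ordinal i3 = 0) //; apply: val_inj.
- by rewrite (_ : Ordinal i3 = 1) //; apply: val_inj.
- by rewrite (_ : Ordinal i3 = 2) //; apply: val_inj.
Qed.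

(** The join of two distinct points, and dually the meet of two distinct lines. *)
Definition cross u v : 'rV[F]_3 := \row_(i < 3)
  [:: u 0 1 * v 0 2 - u 0 2 * v 0 1; u 0 2 * v 0 0 - u 0 0 * v 0 2;
      u 0 0 * v 0 1 - u 0 1 * v 0 0]`_i.

Ltac crossE := rewrite ?(dotE, mxE)/= ?(dotE, mxE)/=; ring.

Lemma dot_cross_l u v : dot u (cross u v) = 0. Proof. by crossE. Qed.
Lemma dot_cross_r u v : dot v (cross u v) = 0. Proof. by crossE. Qed.

Lemma crossDr u v w : cross u (v + w) = cross u v + cross u w.
Proof. by apply: rV3_eq; crossE. Qed.

Lemma crossZr k u v : cross u (k *: v) = k *: cross u v.
Proof. by apply: rV3_eq; crossE. Qed.

Lemma cross0 u : cross u 0 = 0.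
Proof. by apply: rV3_eq; crossE. Qed.

Lemma crossC u v : cross v u = - cross u v.
Proof. by apply: rV3_eq; crossE. Qed.

Lemma cross_id u : cross u u = 0.
Proof. by apply: rV3_eq; crossE. Qed.

Lemma cross_cross u v w : cross u (cross v w) = dot u w *: v - dot u v *: w.
Proof. by apply: rV3_eq; crossE. Qed.

(** Crossing the relation with [v] kills the term in [v] and isolates [s]; crossing it with [u]
    isolates [t]. *)
Lemma cross_neq0_free u v s t :
  cross u v != 0 -> s *: u + t *: v = 0 -> s = 0 /\ t = 0.
Proof.
move=> uv0 e.
have es : s *: cross u v = 0.
  have : cross v (s *: u + t *: v) = 0 by rewrite e cross0.
  rewrite crossDr !crossZr cross_id scaler0 addr0 (crossC u) scalerN.
  by move/eqP; rewrite oppr_eq0 => /eqP.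
have et : t *: cross u v = 0.
  have : cross u (s *: u + t *: v) = 0 by rewrite e cross0.
  by rewrite crossDr !crossZr cross_id scaler0 add0r.
by split; apply/eqP; [move/eqP: es|move/eqP: et];
  rewrite scaler_eq0 (negbTE uv0) orbF.
Qed.

Lemma rank_col_mx_cross u v : cross u v != 0 -> \rank (col_mx u v) = 2.
Proof.
move=> uv0; apply/eqP; rewrite -[_ == _]/(row_free _) -kermx_eq0; apply/rowV0P.
move=> w /sub_kermxP; rewrite -[w]hsubmxK mul_row_col.
rewrite [lsubmx w]mx11_scalar [rsubmx w]mx11_scalar !mul_scalar_mx.
by move=> /(cross_neq0_free uv0)[-> ->]; rewrite !raddf0 row_mx0.
Qed.

(** A totally isotropic plane would give two matrices of rank 2 with product zero in dimension 3,
    where the ranks may add up to at most 3. Applied to [M] this says that a regular conic contains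
    no line; applied to the dual form, that not all lines of a pencil are isotropic. *)
Lemma regular_no_isotropic_line M u v : M \in unitmx -> cross u v != 0 ->
  dot (u *m M) u = 0 -> dot (u *m M) v = 0 -> dot (v *m M) u = 0 ->
  dot (v *m M) v = 0 -> False.
Proof.
move=> uM uv0 uu uv vu vv; have rk := rank_col_mx_cross uv0.
have : (col_mx u v *m M) *m (col_mx u v)^T = 0.
  rewrite mul_col_mx tr_col_mx mul_col_row !dot_mx uu uv vu vv !raddf0.
  by rewrite /block_mx !row_mx0 col_mx0.
move/mulmx0_rank_max; rewrite mxrank_tr mxrankMfree ?rk //.
by rewrite row_free_unit.
Qed.

End Field.

(** * Proportionality via cross products over an ordered field *)

Section RealField.
Variable R : realFieldType.
Implicit Types (u v w x y p q r l m h f g : 'rV[R]_3) (M N : 'M[R]_3) (k : R).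

Lemma dot_self_eq0 u : (dot u u == 0) = (u == 0).
Proof.
apply/eqP/eqP => [|->]; last by rewrite dotE !mxE; ring.
rewrite dotE => e.
have [e0 e1 e2] : [/\ u 0 0 = 0, u 0 1 = 0 & u 0 2 = 0].
  by split; nra.
by apply: rV3_eq; rewrite mxE.
Qed.

(** Expand u x (u x v) = (u.v) u - (u.u) v, where u.u is nonzero because the field is ordered. *)
Lemma cross_eq0_scale u v : u != 0 -> cross u v = 0 -> exists k, v = k *: u.
Proof.
move=> u0 uv0; exists ((dot u u)^-1 * dot u v).
have : cross u (cross u v) = 0 by rewrite uv0 cross0.
rewrite cross_cross => /eqP; rewrite subr_eq0 => /eqP e.
by rewrite -scalerA e scalerA mulVf ?scale1r // dot_self_eq0.
Qed.

Lemma same_elt_cross u v : u != 0 -> v != 0 ->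
  same_elt u v = (cross u v == 0).
Proof.
move=> u0 v0; apply/same_eltP/eqP => [[k _ ->]|].
  by rewrite crossC crossZr cross_id scaler0 oppr0.
move/(cross_eq0_scale u0) => [k vE].
have k0 : k != 0 by apply: contra_neq v0 => k0; rewrite vE k0 scale0r.
by exists k^-1; rewrite ?invr_eq0 // vE scalerA mulVf ?scale1r.
Qed.

Lemma dot_eq0_cross u v l : cross u v != 0 -> dot u l = 0 -> dot v l = 0 ->
  exists k, l = k *: cross u v.
Proof.
move=> uv0 ul vl; apply: cross_eq0_scale => //.
by rewrite crossC cross_cross dotC vl dotC ul !scale0r subrr oppr0.
Qed.

(** In characteristic 0 a polynomial vanishing everywhere is zero, and the polynomial ring is a
    domain. *)
Lemma quadratic_mul_eq0 (a0 a1 a2 b0 b1 b2 : R) :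
  (forall t, (a0 + a1 * t + a2 * t ^+ 2) * (b0 + b1 * t + b2 * t ^+ 2) = 0) ->
  [/\ a0 = 0, a1 = 0 & a2 = 0] \/ [/\ b0 = 0, b1 = 0 & b2 = 0].
Proof.
move=> ab0; pose P (c0 c1 c2 : R) := Poly [:: c0; c1; c2].
have PE c0 c1 c2 t : (P c0 c1 c2).[t] = c0 + c1 * t + c2 * t ^+ 2.
  by rewrite /P !horner_Poly /=; ring.
have P0 c0 c1 c2 : P c0 c1 c2 = 0 -> [/\ c0 = 0, c1 = 0 & c2 = 0].
  by move=> /polyP e; split; [have := e 0|have := e 1|have := e 2];
    rewrite coef_Poly coef0.
have /eqP : P a0 a1 a2 * P b0 b1 b2 = 0.
  apply/eqP/negPn/negP => nz.
  (* As many distinct roots as the size of the product, one more than its degree. *)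
  pose rs := [seq i%:R : R | i <- iota 0 (size (P a0 a1 a2 * P b0 b1 b2))].
  have := @max_poly_roots _ _ rs nz.
  rewrite size_map size_iota ltnn => H; suff: false by []; apply: H.
    by apply/allP => t _; rewrite rootE hornerM !PE ab0.
  by rewrite map_inj_uniq ?iota_uniq //; apply: mulrIn; exact: oner_neq0.
by rewrite mulf_eq0 => /orP[/eqP/P0|/eqP/P0]; [left|right].
Qed.

(** * The Fregier point as a linear image of p: existence and uniqueness *)

Definition fregier_mx M N : 'M[R]_3 :=
  2 *: (M *m invmx N) - (\tr (M *m invmx N))%:M.

Section Fregier.
Variables M N : 'M[R]_3.
Hypotheses (sM : M^T = M) (uM : M \in unitmx) (sN : N^T = N) (uN : N \in unitmx).

Lemma tr_invmx_sym : (invmx N)^T = invmx N.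
Proof. by rewrite trmx_inv sN. Qed.

(** Two distinct conjugate points of the conic would make their whole join lie on it. *)
Lemma isotropic_dot_neq0 u v : cross u v != 0 ->
  dot (u *m M) u = 0 -> dot (v *m M) v = 0 -> dot (u *m M) v != 0.
Proof.
move=> uv0 uu vv; apply/eqP => uv.
by apply: (regular_no_isotropic_line uM uv0) => //; rewrite dot_sym.
Qed.

Lemma fregier_on_hypotenuse_generic p q r l m h :
  dot (p *m M) p = 0 -> dot (q *m M) q = 0 -> dot (r *m M) r = 0 ->
  cross p q != 0 -> cross p r != 0 -> cross q r != 0 ->
  l != 0 -> m != 0 -> dot p l = 0 -> dot q l = 0 -> dot p m = 0 ->
  dot r m = 0 -> dot q h = 0 -> dot r h = 0 ->
  dot (l *m invmx N) m = 0 -> dot (p *m fregier_mx M N) h = 0.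
Proof.
move=> pp qq rr pq pr qr l0 m0 pl ql pm rm qh rh lm.
have al := isotropic_dot_neq0 qr qq rr.
have be := isotropic_dot_neq0 pr pp rr.
have ga := isotropic_dot_neq0 pq pp qq.
pose P : 'M[R]_3 := \matrix_(i < 3) [:: p; q; r]`_i.
pose G := P *m M *m P^T.
have GE i j : G i j = dot ([:: p; q; r]`_i *m M) [:: p; q; r]`_j.
  by rewrite mulmx_tr_dot row_mul !rowK.
have GP : P *m M *m P^T = G by [].
clearbody G.
have rG i j : row j G 0 i = G j i by rewrite mxE.
(* A relation v P = 0 gives v G = 0, but G has zero diagonal and determinant 2 [al] [be] [ga], which
   is nonzero. *)
have uP : P \in unitmx.
  rewrite -row_free_unit -kermx_eq0; apply/rowV0P => v /sub_kermxP vP.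
  have vG j : dot v (row j G) = 0.
    have /matrixP/(_ 0 j) : v *m G^T = 0.
      by rewrite -GP !trmx_mul trmxK sM !mulmxA vP !mul0mx.
    by rewrite mulmx_tr_dot mxE; congr (dot _ _ = _); apply: rV3_eq; rewrite !mxE.
  have := (vG 0, vG 1, vG 2); rewrite !dotE !rG !GE /= pp qq rr.
  rewrite (dot_sym q p sM) (dot_sym r p sM) (dot_sym r q sM).
  rewrite !(mulr0, add0r, addr0) => -[[e0 e1] e2].
  have v0 : v 0 0 = 0.
    apply/eqP; move: (mulf_neq0 be ga) => /negbTE bg.
    have : v 0 0 * (2 * (dot (p *m M) r * dot (p *m M) q)) = 0 by nra.
    by move/eqP; rewrite mulf_eq0 mulf_eq0 bg pnatr_eq0 !orbF.
  apply: rV3_eq; rewrite mxE //.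
    by move/eqP: e2; rewrite v0 mul0r add0r mulf_eq0 (negbTE al) orbF => /eqP.
  by move/eqP: e1; rewrite v0 mul0r add0r mulf_eq0 (negbTE al) orbF => /eqP.
(* [k 0], [k 1], [k 2] is the dual basis, so its members represent the side lines qr, rp, pq. Hence
   [l], [m] and [h] are multiples of [k 2], [k 1] and [k 0], and H is the Gram matrix of the dual
   form in this basis. *)
pose Q := invmx P; pose k i := row i Q^T.
have kE x : x = dot x p *: k 0 + dot x q *: k 1 + dot x r *: k 2.
  have : x = (x *m P^T) *m Q^T by rewrite -mulmxA -trmx_mul mulVmx // trmx1 mulmx1.
  rewrite (mulmx_sum_row (x *m P^T)) sum_ord3 !mulmx_tr_dot !rowK /=.
  by rewrite (_ : row 0 x = x) //; apply: rV3_eq; rewrite !mxE.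
have lE : l = dot l r *: k 2.
  by rewrite {1}(kE l) (dotC l p) (dotC l q) pl ql !scale0r !add0r.
have mE : m = dot m q *: k 1.
  by rewrite {1}(kE m) (dotC m p) (dotC m r) pm rm !scale0r add0r addr0.
have hE : h = dot h p *: k 0.
  by rewrite {1}(kE h) (dotC h q) (dotC h r) qh rh !scale0r !addr0.
pose H := Q^T *m invmx N *m Q.
have HE i j : H i j = dot (k i *m invmx N) (k j).
  by rewrite /H -[X in (_ *m X) i j]trmxK mulmx_tr_dot row_mul.
have HQ : Q^T *m (invmx N *m Q) = H by rewrite mulmxA.
clearbody H.
have Hs i j : H i j = H j i by rewrite !HE dot_sym // tr_invmx_sym.
have H21 : H 2 1 = 0.
  move: lm; rewrite lE mE -scalemxAl dotZl dotZr -HE => /eqP.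
  rewrite !mulf_eq0 => /orP[/eqP e|/orP[/eqP e|/eqP //]].
    by rewrite lE e scale0r eqxx in l0.
  by rewrite mE e scale0r eqxx in m0.
have pk0 : dot p (k 0) = 1.
  have : (P *m Q^T^T) 0 0 = 1 by rewrite trmxK mulmxV // mxE.
  by rewrite mulmx_tr_dot rowK.
(* The trace is that of G H; the diagonal of G and the entry H_21 vanish, leaving only the terms
   with index 0. *)
have trE : \tr (M *m invmx N) = 2 * (G 0 1 * H 1 0 + G 0 2 * H 2 0).
  have -> : M = Q *m G *m Q^T.
    by rewrite -GP !mulmxA mulVmx // mul1mx -mulmxA -trmx_mul mulVmx // trmx1 mulmx1.
  rewrite -!mulmxA mxtrace_mulC -!mulmxA HQ.
  rewrite /mxtrace sum_ord3 !mulmx3E !GE /= pp qq rr.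
  rewrite (Hs 0 1) (Hs 0 2) (Hs 1 2) H21.
  by rewrite (dot_sym q p sM) (dot_sym r p sM); ring.
rewrite hE dotZr /fregier_mx mulmxBr -scalemxAr mul_mx_scalar mulmxA.
rewrite -scaleN1r dotDl !dotZl pk0 trE {1}(kE (p *m M)) pp scale0r add0r.
by rewrite mulmxDl -!scalemxAl dotDl !dotZl -!HE !GE /=; ring.
Qed.

Lemma fregier_on_hypotenuses p : p != 0 -> on_conic M p ->
  p *m fregier_mx M N != 0 -> on_hypotenuses N M p (p *m fregier_mx M N).
Proof.
move=> p0; rewrite on_conicE => /eqP pp f0; split=> // l m q r.
rewrite /secant !incidentE !on_conicE.
move=> [[l0 q0 /eqP pl /eqP ql /eqP qq] pql] [[m0 r0 /eqP pm /eqP rm /eqP rr] prm].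
rewrite orthogonalE => /eqP lm; rewrite same_elt_cross // => qr h h0.
rewrite !incidentE => /eqP qh /eqP rh; apply/eqP.
(* If one leg is the tangent p M, orthogonality says that p M N^-1 lies on the other leg; so does p,
   hence also p T. *)
have tangent l' m' : dot (l' *m invmx N) m' = 0 -> dot p m' = 0 ->
    same_elt l' (polar M p) -> dot (p *m fregier_mx M N) m' = 0.
  move=> lm' pm' /same_eltP[k k0 lE].
  rewrite /fregier_mx mulmxBr -scalemxAr mul_mx_scalar -scaleN1r dotDl !dotZl.
  move: lm'; rewrite lE -scalemxAl dotZl pm' /polar mulmxA => /eqP.
  by rewrite mulf_eq0 (negbTE k0) => /eqP ->; ring.
(* If both legs are tangent, q and r coincide with p, which is excluded. If exactly one is, the
   hypotenuse is the other leg. *)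
have [pq|pq] := boolP (same_elt p q); have [pr|pr] := boolP (same_elt p r).
- have [j j0 pE] := same_eltP _ _ pq; have [k k0 pE'] := same_eltP _ _ pr.
  case/negP: qr; rewrite -same_elt_cross //; apply/same_eltP; exists (j^-1 * k).
    by rewrite mulf_neq0 ?invr_eq0.
  by rewrite -scalerA -pE' pE scalerA mulVf ?scale1r.
- have [j j0 pE] := same_eltP _ _ pq.
  have ph : dot p h = 0 by rewrite pE dotZl qh mulr0.
  rewrite same_elt_cross // in pr.
  have [c hE] := dot_eq0_cross pr ph rh; have [d mE] := dot_eq0_cross pr pm rm.
  have d0 : d != 0 by apply: contra_neq m0 => d0; rewrite mE d0 scale0r.
  have : dot (p *m fregier_mx M N) m = 0 by apply: tangent lm pm (pql pq).
  rewrite hE mE !dotZr => /eqP; rewrite mulf_eq0 (negbTE d0) => /eqP ->.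
  by rewrite mulr0.
- have [j j0 pE] := same_eltP _ _ pr.
  have ph : dot p h = 0 by rewrite pE dotZl rh mulr0.
  rewrite same_elt_cross // in pq.
  have [c hE] := dot_eq0_cross pq ph qh; have [d lE] := dot_eq0_cross pq pl ql.
  have d0 : d != 0 by apply: contra_neq l0 => d0; rewrite lE d0 scale0r.
  have : dot (p *m fregier_mx M N) l = 0.
    by apply: tangent pl (prm pr); rewrite dot_sym ?tr_invmx_sym.
  rewrite hE lE !dotZr => /eqP; rewrite mulf_eq0 (negbTE d0) => /eqP ->.
  by rewrite mulr0.
- rewrite !same_elt_cross // in pq pr.
  exact: (fregier_on_hypotenuse_generic pp qq rr pq pr qr l0 m0 pl ql pm rm).
Qed.

(** The second intersection of M with the line pd: for p on M, the form at x p + y d is y (2 x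
    B(p,d) + y B(d,d)), and the second factor is solved for (x, y). It is proportional to p when the
    line is tangent. *)
Definition second_point p d :=
  dot (d *m M) d *: p - (2 * dot (p *m M) d) *: d.

Lemma secant_cross p d : p != 0 -> on_conic M p -> cross p d != 0 ->
  secant M p (cross p d) (second_point p d).
Proof.
move=> p0; rewrite on_conicE => /eqP pp pd0; rewrite /secant !incidentE.
have pM0 : p *m M != 0.
  by apply: contra_neq p0 => /(congr1 (mulmx^~ (invmx M))); rewrite mulmxK // mul0mx.
(* If both coefficients vanished, the line pd would lie on M. *)
have q0 : second_point p d != 0.
  apply/eqP; rewrite /second_point -scaleNr => /(cross_neq0_free pd0)[dd /eqP].
  rewrite oppr_eq0 mulf_eq0 pnatr_eq0 /= => /eqP pd.
  by apply: (regular_no_isotropic_line uM pd0) => //; rewrite dot_sym.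
split.
  split=> //; rewrite ?dot_cross_l ?eqxx //.
    by rewrite /second_point -scaleNr dotDl !dotZl dot_cross_l dot_cross_r !mulr0 addr0.
  rewrite on_conicE /second_point -scaleNr mulmxDl -!scalemxAl.
  rewrite !(dotDl, dotDr, dotZl, dotZr) pp (dot_sym d p sM); apply/eqP; ring.
(* If the second point is p, then d is conjugate to p, so the polar of p passes through p and d. *)
rewrite same_elt_cross // /second_point -scaleNr crossDr !crossZr cross_id.
rewrite scaler0 add0r scaler_eq0 oppr_eq0 mulf_eq0 pnatr_eq0 (negbTE pd0) orbF /=.
move=> /eqP pd; have [||k pME] := @dot_eq0_cross p d (p *m M) pd0.
- by rewrite dotC.
- by rewrite dotC.
have k0 : k != 0 by apply: contra_neq pM0 => k0; rewrite pME k0 scale0r.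
apply/same_eltP; exists k^-1; rewrite ?invr_eq0 //.
by rewrite /polar pME scalerA mulVf ?scale1r.
Qed.

(* A line l through p which is not isotropic is distinct from its orthogonal
   line through p, so it carries the endpoint of a hypotenuse. *)
Lemma second_point_on_hypotenuse p d f g : p != 0 -> on_conic M p ->
  on_hypotenuses N M p f -> on_hypotenuses N M p g -> cross f g != 0 ->
  cross p d != 0 -> dot (cross p d *m invmx N) (cross p d) != 0 ->
  dot (second_point p d) (cross f g) = 0.
Proof.
move=> p0 pM [f0 Hf] [g0 Hg] fg0 pd0 ni; set l := cross p d in ni *.
(* [w] is the pole of [l] with respect to N, so pw is the line through p orthogonal to [l]. It is
   well defined, since p is not this pole: [l] is not isotropic. *)
pose w := l *m invmx N.
have pw0 : cross p w != 0.
  apply: contra_neq ni => /(cross_eq0_scale p0)[k wE].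
  by rewrite -/w wE dotZl dot_cross_l mulr0.
have Sq := secant_cross p0 pM pd0; have Sr := secant_cross p0 pM pw0.
set q := second_point p d in Sq *; set r := second_point p w in Sr.
have lm : Defs.orthogonal N l (cross p w) by rewrite orthogonalE dot_cross_r.
have nlm : ~ same_elt l (cross p w).
  by move=> /same_eltP[k k0 lE]; case/eqP: ni; rewrite {2}lE dotZr dot_cross_r mulr0.
(* If q and r coincide, both legs are the tangent at p or both are the line pq; but a non-isotropic
   line is not orthogonal to itself. *)
have qr : ~~ same_elt q r.
  apply/negP => /same_eltP[k k0 qE]; apply: nlm.
  move: Sq Sr => [[_ q0 _ ql _] pq] [[_ r0 _ rm _] pr].
  have [pqs|pqs] := boolP (same_elt p q).
    have /same_eltP[i i0 lE] := pq pqs.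
    have prs : same_elt p r.
      have /same_eltP[j j0 pE] := pqs; apply/same_eltP; exists (j * k).
        exact: mulf_neq0.
      by rewrite pE qE scalerA.
    have /same_eltP[j j0 mE] := pr prs; apply/same_eltP; exists (i / j).
      by rewrite mulf_neq0 ?invr_eq0.
    by rewrite /l lE mE scalerA mulfVK.
  rewrite same_elt_cross // in pqs.
  move: ql rm; rewrite !incidentE => /eqP ql /eqP rm.
  have qm : dot q (cross p w) = 0 by rewrite qE dotZl rm mulr0.
  have [i lE] := dot_eq0_cross pqs (dot_cross_l p d) ql.
  have [j mE] := dot_eq0_cross pqs (dot_cross_l p w) qm.
  have j0 : j != 0 by apply: contra_neq pw0 => j0; rewrite mE j0 scale0r.
  have i0 : i != 0 by apply: contra_neq pd0 => i0; rewrite lE i0 scale0r.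
  apply/same_eltP; exists (i / j); first by rewrite mulf_neq0 ?invr_eq0.
  by rewrite /l lE mE scalerA mulfVK.
have := qr; rewrite same_elt_cross; [|by case: Sq => -[]|by case: Sr => -[]].
move=> qr0; have hq := dot_cross_l q r; have hr := dot_cross_r q r.
(* Both f and g lie on the hypotenuse qr, so it is the line fg, and q lies on it. *)
have := Hf _ _ _ _ Sq Sr lm qr _ qr0; have := Hg _ _ _ _ Sq Sr lm qr _ qr0.
rewrite !incidentE hq hr eqxx => /(_ isT isT)/eqP gh /(_ isT isT)/eqP fh.
have [k hE] := dot_eq0_cross fg0 fh gh.
have k0 : k != 0 by apply: contra_neq qr0 => k0; rewrite hE k0 scale0r.
move/eqP: hq; rewrite hE dotZr mulf_eq0 (negbTE k0) => /eqP //.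
Qed.

(* Otherwise, by the previous lemma, the product of two quadratic polynomials in
   the parameter of a line through p vanishes: one is zero at the isotropic lines,
   the other where the second intersection with M lies on the line fg. The
   Euclidean orthogonal basis p, s, s x p, with s the tangent at p, makes the
   coefficients explicit. *)
Lemma on_hypotenuses_unique p f g : p != 0 -> on_conic M p ->
  on_hypotenuses N M p f -> on_hypotenuses N M p g -> same_elt g f.
Proof.
move=> p0 pM Hf Hg; rewrite same_elt_sym same_elt_cross ?Hf.1 ?Hg.1 //.
apply/negPn/negP => fg0; set h := cross f g in fg0.
have pp : dot (p *m M) p = 0 by apply/eqP; rewrite -on_conicE.
pose s := p *m M; pose e := cross s p.
have s0 : s != 0.
  by apply: contra_neq p0 => /(congr1 (mulmx^~ (invmx M))); rewrite mulmxK // mul0mx.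
have ps : dot p s = 0 by rewrite dotC.
have pe : cross p e = dot p p *: s.
  by rewrite cross_cross ps scale0r subr0.
have p2 : dot p p != 0 by rewrite dot_self_eq0.
have s2 : dot s s != 0 by rewrite dot_self_eq0.
have pe0 : cross p e != 0 by rewrite pe scaler_eq0 negb_or p2.
have se0 : dot s e = 0 by apply: dot_cross_l.
have sM0 : dot (p *m M) s != 0 by [].
have ee0 : dot (e *m M) e != 0.
  apply/eqP => ee; apply: (regular_no_isotropic_line uM pe0) => //.
  by rewrite dot_sym.
have free t : cross p (e + t *: s) != 0.
  apply/eqP => /(congr1 (fun x => dot x s)).
  rewrite crossDr crossZr pe dotDl !dotZl (dotC _ s) dot_cross_r mulr0 addr0.
  by move/eqP; rewrite [dot 0 s]dotE !mxE !mul0r !addr0 mulf_eq0 (negbTE p2) (negbTE s2).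
(* The dual form on the pencil of lines through p; [n u u] = 0 means that pu is isotropic. The first
   quadratic below is [n] at e + t s, the second is the incidence of the second intersection point
   with fg. *)
pose n u v := dot (cross p u *m invmx N) (cross p v).
have nC u v : n u v = n v u by rewrite /n dot_sym // tr_invmx_sym.
have [||] := @quadratic_mul_eq0 (n e e) (2 * n e s) (n s s)
    (dot (e *m M) e * dot p h)
    (2 * dot (e *m M) s * dot p h - 2 * dot (p *m M) s * dot e h)
    (dot (s *m M) s * dot p h - 2 * dot (p *m M) s * dot s h).
- move=> t; have [ni|ni] := eqVneq (n (e + t *: s) (e + t *: s)) 0.
    move: ni; rewrite /n crossDr crossZr mulmxDl -scalemxAl.
    rewrite !(dotDl, dotDr, dotZl, dotZr) -/(n _ _) -/(n _ _) -/(n _ _).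
    rewrite -/(n _ _) (nC s) => ni; apply/eqP; rewrite mulf_eq0; apply/orP; left.
    by apply/eqP; rewrite -ni; ring.
  have := second_point_on_hypotenuse p0 pM Hf Hg fg0 (free t) ni.
  rewrite -/h /second_point -scaleNr mulmxDl -!scalemxAl.
  rewrite !(dotDl, dotDr, dotZl, dotZr) -/s se0 (dot_sym s e sM) => E.
  apply/eqP; rewrite mulf_eq0; apply/orP; right; apply/eqP; rewrite -E; ring.
(* If the first factor is zero, every line through p is isotropic, contradicting the regularity of
   the dual form. *)
- case=> nee nes nss; have uN' : invmx N \in unitmx by rewrite unitmx_inv.
  have [c0|c0] := eqVneq (cross (cross p e) (cross p s)) 0; last first.
    have nes0 : n e s = 0.
      by move/eqP: nes; rewrite mulf_eq0 pnatr_eq0 => /eqP.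
    by apply: (regular_no_isotropic_line uN' c0) => //; rewrite -/(n s e) nC.
  move/eqP: c0; rewrite cross_cross (dotC _ p) dot_cross_l scale0r subr0 pe.
  by rewrite dotZl scaler_eq0 mulf_eq0 (negbTE p2) (negbTE s2) (negbTE p0).
(* If the second factor is zero, the line [h] contains the independent points p, e, s. *)
case=> /eqP; rewrite mulf_eq0 (negbTE ee0) /= => /eqP ph.
rewrite ph !mulr0 !sub0r => /eqP; rewrite oppr_eq0 mulf_eq0 mulf_eq0.
rewrite pnatr_eq0 (negbTE sM0) /= => /eqP eh /eqP.
rewrite oppr_eq0 mulf_eq0 mulf_eq0 pnatr_eq0 (negbTE sM0) /= => /eqP sh.
have [k hE] := dot_eq0_cross pe0 ph eh.
move/eqP: sh; rewrite hE pe !dotZr !mulf_eq0 (negbTE p2) (negbTE s2) !orbF.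
by move=> /eqP k0; rewrite hE k0 scale0r eqxx in fg0.
Qed.

Lemma is_fregier_pointP p f : p != 0 -> on_conic M p ->
  p *m fregier_mx M N != 0 ->
  is_fregier_point N M p f <-> same_elt f (p *m fregier_mx M N).
Proof.
move=> p0 pM T0; have HT := fregier_on_hypotenuses p0 pM T0.
split=> [[_ /(_ _ HT)]|/same_eltP[k k0 fE]]; first by rewrite same_elt_sym.
have Hf : on_hypotenuses N M p f.
  split=> [|l m q r Sq Sr lm qr h h0 qh rh]; first by rewrite fE scaler_eq0 negb_or k0.
  have := HT.2 l m q r Sq Sr lm qr h h0 qh rh.
  by rewrite !incidentE fE dotZl => /eqP ->; rewrite mulr0.
by split=> // g Hg; apply: on_hypotenuses_unique Hf Hg.
Qed.

End Fregier.
End RealField.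

(** * Conics in diagonal form *)

Section Diagonal.
Variable F : fieldType.
Implicit Types (x p : 'rV[F]_3).

Lemma on_conic_diag (c : 'rV[F]_3) x :
  on_conic (diag_mx c) x = (\sum_i c 0 i * x 0 i ^+ 2 == 0).
Proof.
rewrite on_conicE /dot mul_mx_diag mxE; congr (_ == 0).
by apply: eq_bigr => i _; rewrite !mxE; ring.
Qed.

Lemma on_axis_conic c1 c2 x : on_conic (axis_conic c1 c2) x =
  (c1 * x 0 1 ^+ 2 + c2 * x 0 2 ^+ 2 == x 0 0 ^+ 2).
Proof.
rewrite on_conic_diag sum_ord3 !mxE /= -subr_eq0 -[RHS]subr_eq0.
by congr (_ == 0); ring.
Qed.

Lemma tr_axis_conic c1 c2 : (axis_conic c1 c2 : 'M[F]_3)^T = axis_conic c1 c2.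
Proof. exact: tr_diag_mx. Qed.

Lemma axis_conic_unit c1 c2 : c1 != 0 -> c2 != 0 ->
  (axis_conic c1 c2 : 'M[F]_3) \in unitmx.
Proof.
move=> c10 c20; rewrite unitmxE unitfE det_diag !big_ord_recr big_ord0 /= !mxE /=.
by rewrite mul1r !mulf_neq0 ?oppr_eq0 ?oner_eq0.
Qed.

Lemma axis_conic_regular c1 c2 : c1 != 0 -> c2 != 0 ->
  is_regular_conic (conic_set (axis_conic c1 c2 : 'M[F]_3)).
Proof.
by exists (axis_conic c1 c2); split; rewrite ?tr_axis_conic ?axis_conic_unit.
Qed.

(** The contact points are [1, 0, 1] and [1, 0, -1] if [c2] = 1, and otherwise [1, 1, 0] and
    [1, -1, 0]. *)
Lemma double_contact_axis_conic c1 c2 : (2 : F) != 0 -> c1 = 1 \/ c2 = 1 ->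
  double_contact (axis_conic c1 c2) (axis_conic 1 1 : 'M[F]_3).
Proof.
move=> two0 c12; pose e (k : F) : 'rV[F]_3 :=
  \row_(i < 3) (if c2 == 1 then [:: 1; 0; k]`_i else [:: 1; k; 0]`_i).
have touch_e k : k ^+ 2 = 1 -> touch (axis_conic c1 c2) (axis_conic 1 1) (e k).
  move=> k2; split.
  - apply/eqP => /rowP/(_ 0) /eqP; rewrite !mxE /=.
    by case: ifP; rewrite oner_eq0.
  - rewrite on_axis_conic /e !mxE /=; case: c12 => ->; last first.
      by rewrite eqxx /= k2; apply/eqP; ring.
    by case: (eqVneq c2 1) => [->|_]; rewrite k2; apply/eqP; ring.
  - by rewrite on_axis_conic /e !mxE /=; case: ifP; rewrite k2 => _; apply/eqP; ring.
  apply/same_eltP; exists 1; rewrite ?oner_eq0 // scale1r /polar /axis_conic.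
  rewrite !mul_mx_diag /e; apply: rV3_eq; rewrite !mxE //=; first last.
  - by case: (eqVneq c2 1) => [->|_]; rewrite ?mul0r.
  - by case: c12 => ->; rewrite ?eqxx ?mul0r.
exists (e 1), (e (-1)); split; [|apply: touch_e; ring|apply: touch_e; ring].
apply/negP => /same_eltP[k _ ek].
have := (congr1 (fun x : 'rV_3 => x 0 0) ek, congr1 (fun x : 'rV_3 => x 0 1) ek,
  congr1 (fun x : 'rV_3 => x 0 2) ek).
rewrite !mxE /= => -[[]].
case: ifP => _; rewrite mulr1 => <-; rewrite !mul1r => e1 e2.
  by case/eqP: two0; apply/eqP; rewrite -[2]/(1 + 1) addr_eq0; apply/eqP; exact: e2.
by case/eqP: two0; apply/eqP; rewrite -[2]/(1 + 1) addr_eq0; apply/eqP; exact: e1.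
Qed.

(** With at most one zero entry in [t], the kernel of the diagonal map is at most a coordinate axis,
    spanned by a vector where the form takes the nonzero value c_i. *)
Lemma mul_diag_conic_neq0 (c t : 'rV[F]_3) p : (forall i, c 0 i != 0) ->
  (forall i j, i != j -> t 0 i = 0 -> t 0 j != 0) ->
  p != 0 -> on_conic (diag_mx c) p -> p *m diag_mx t != 0.
Proof.
move=> c0 t0 p0; rewrite on_conic_diag => pc; apply: contra_neq p0 => pt0.
have pt i : p 0 i * t 0 i = 0.
  by move/rowP/(_ i): pt0; rewrite mul_mx_diag !mxE.
apply/rowP => i; rewrite mxE; apply/eqP/negPn/negP => pi0.
have ti : t 0 i = 0.
  by move/eqP: (pt i); rewrite mulf_eq0 (negbTE pi0) => /eqP.
move: pc; rewrite (bigD1 i) //= big1 ?addr0 => [|j ji].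
  by rewrite mulf_eq0 expf_eq0 (negbTE (c0 i)) (negbTE pi0).
have := pt j; move/eqP; rewrite mulf_eq0 (negbTE (t0 i j _ ti)) 1?[i == j]eq_sym //.
by rewrite orbF => /eqP ->; rewrite expr2 !mulr0.
Qed.

End Diagonal.

(** * Projective segments and the conics containing them *)

Section Segment.
Variable R : realType.
Implicit Types (u v x l : 'rV[R]_3) (M N : 'M[R]_3).

Lemma incident_axis_line x i : incident x (axis_line R i) = (x 0 i == 0).
Proof.
rewrite incidentE /dot /axis_line trmx_delta mxE (bigD1 i) //= big1 ?addr0.
  by rewrite mxE !eqxx mulr1.
by move=> j ji; rewrite mxE (negbTE ji) mulr0.
Qed.

(** A segment contains two points u, v and also u + v; if all three are on M, bilinearity gives 2
    B(u,v) = 0. *)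
Lemma projective_segment_conic l M : M^T = M -> l != 0 ->
  projective_segment l (conic_set M) ->
  exists u v, [/\ cross u v != 0, dot u l = 0, dot v l = 0 &
    [/\ dot (u *m M) u = 0, dot (u *m M) v = 0 & dot (v *m M) v = 0]].
Proof.
move=> sM l0 S.
suff [u [v [uv0 ul vl [uu vv uv]]]] : exists u v, [/\ cross u v != 0, dot u l = 0,
    dot v l = 0 & [/\ conic_set M u, conic_set M v & conic_set M (u + v)]].
  case: uu vv uv => [_ +] [_ +] [_]; rewrite !on_conicE => /eqP uu /eqP vv.
  rewrite mulmxDl !(dotDl, dotDr) uu vv (dot_sym v u sM) => /eqP uv.
  by exists u, v; split=> //; split=> //; lra.
case: S => [SE|[u [v [[u0 v0 nuv ul vl] SE]]]]; rewrite SE /=.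
  have [u u0 ul] : exists2 u, u != 0 & dot u l = 0.
    (* A point of [l] is found as its meet with a coordinate axis line; if both products vanish, so
       does [l]. *)
    have [e|e] := eqVneq (cross l (delta_mx 0 0)) 0; last first.
      by exists (cross l (delta_mx 0 0)); rewrite // dotC dot_cross_l.
    have [e'|e'] := eqVneq (cross l (delta_mx 0 1)) 0; last first.
      by exists (cross l (delta_mx 0 1)); rewrite // dotC dot_cross_l.
    case/eqP: l0; move/rowP: e => e; move/rowP: e' => e'.
    move: (e 1) (e 2) (e' 2); rewrite !mxE /= => e1 e2 e3.
    by apply: rV3_eq; rewrite mxE; lra.
  pose v := cross l u; exists u, v.
  have vl : dot v l = 0 by rewrite dotC dot_cross_l.
  have uv0 : cross u v != 0.
    by rewrite /v cross_cross ul scale0r subr0 scaler_eq0 dot_self_eq0 negb_or u0.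
  have free s t : s *: u + t *: v = 0 -> s = 0 /\ t = 0.
    exact: cross_neq0_free.
  rewrite !incidentE dotDl ul vl addr0 eqxx u0; split=> //; split=> //; split=> //.
    by apply: contra_neq uv0 => ->; rewrite cross0.
  apply/eqP => uv; have [|/eqP] := free 1 1; first by rewrite !scale1r.
  by rewrite oner_eq0.
move: ul vl; rewrite !incidentE => /eqP ul /eqP vl.
exists u, v; rewrite same_elt_cross // in nuv; split=> //; split; split=> //.
- exists 1, 0; split; rewrite ?ler01 // scale1r scale0r addr0.
  by apply/same_eltP; exists 1; rewrite ?oner_eq0 ?scale1r.
- exists 0, 1; split; rewrite ?ler01 // scale1r scale0r add0r.
  by apply/same_eltP; exists 1; rewrite ?oner_eq0 ?scale1r.
- apply/eqP => uv; have [|/eqP] := cross_neq0_free (s := 1) (t := 1) nuv.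
    by rewrite !scale1r.
  by rewrite oner_eq0.
- exists 1, 1; split; rewrite ?ler01 // !scale1r.
  by apply/same_eltP; exists 1; rewrite ?oner_eq0 ?scale1r.
Qed.

Lemma projective_segment_singular l (S : set 'rV[R]_3) : l != 0 ->
  projective_segment l S -> is_singular S.
Proof.
move=> l0 + [M [sM uM SE]]; rewrite SE => /(projective_segment_conic sM l0).
case=> u [v [uv0 _ _ [uu uv vv]]].
by apply: (regular_no_isotropic_line uM uv0) => //; rewrite dot_sym.
Qed.

(** The form of the conic vanishes identically on the span of u and v. This settles the case where
    the Fregier locus is a segment and a conic at once. *)
Lemma projective_segment_is_conic l (S : set 'rV[R]_3) : l != 0 ->
  projective_segment l S -> is_conic S ->
  [set x | x != 0 /\ incident x l] `<=` S.
Proof.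
move=> l0 + [M [sM _ SE]]; rewrite SE => /(projective_segment_conic sM l0).
case=> u [v [uv0 ul vl [uu uv vv]]] x /= [x0]; rewrite incidentE => /eqP xl.
split=> //; set w := cross u v in uv0 *.
have [k lE] := dot_eq0_cross uv0 ul vl.
have k0 : k != 0 by apply: contra_neq l0 => k0; rewrite lE k0 scale0r.
have xw : dot x w = 0.
  by move/eqP: xl; rewrite lE dotZr mulf_eq0 (negbTE k0) => /eqP.
have w2 : dot w w != 0 by rewrite dot_self_eq0.
(* Cramer's rule in the basis u, v, w, with determinant w.w and with x.w = 0. *)
have xE : dot w w *: x = dot x (cross v w) *: u + dot x (cross w u) *: v.
  rewrite -[RHS]addr0 -(scale0r w) -xw /w.
  by apply: rV3_eq; rewrite !(dotE, mxE) /=; ring.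
have : dot ((dot w w *: x) *m M) (dot w w *: x) = 0.
  rewrite xE mulmxDl -!scalemxAl !(dotDl, dotDr, dotZl, dotZr).
  by rewrite uu vv (dot_sym v u sM) uv; ring.
rewrite -scalemxAl dotZl dotZr on_conicE => /eqP.
by rewrite !mulf_eq0 (negbTE w2).
Qed.

Section ThreeAxes.
Variables i j k : 'I_3.
Hypotheses (ij : i != j) (ik : i != k) (jk : j != k).

Lemma ord3_cases n : [\/ n = i, n = j | n = k].
Proof.
suff : [|| n == i, n == j | n == k] by case/or3P => /eqP ->; constructor.
move: ij ik jk; rewrite -!val_eqE /=.
by move: (ltn_ord i) (ltn_ord j) (ltn_ord k) (ltn_ord n); lia.
Qed.

Lemma sum_three (E : 'I_3 -> R) : \sum_n E n = E i + E j + E k.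
Proof.
rewrite (bigD1 i) //= (bigD1 j) ?(eq_sym j) //= (bigD1 k) ?(eq_sym k) ?ik ?jk //=.
rewrite big1 ?addr0 ?addrA // => n; case: (ord3_cases n) => -> //;
  by rewrite eqxx ?andbF.
Qed.

(** The endpoints are the zeros (A, B) and (A, -B) of the quadratic form in the coordinates j, k.
    With x = s (A, B) + t (A, -B) the form is (2 A B)^2 s t, so the condition says that s and t do
    not have opposite signs. *)
Lemma projective_segment_hyperbolic (A B : R) : 0 < A -> 0 < B ->
  projective_segment (axis_line R i)
    [set f : 'rV[R]_3 | [/\ f != 0, f 0 i = 0 &
      0 <= (B * f 0 j - A * f 0 k) * (B * f 0 j + A * f 0 k)]].
Proof.
move=> A0 B0; right.
have mxE_scale (c : R) (x : 'rV[R]_3) n : (c *: x) 0 n = c * x 0 n by rewrite mxE.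
have mxE_add (x y : 'rV[R]_3) n : (x + y) 0 n = x 0 n + y 0 n by rewrite mxE.
pose e (s t : R) : 'rV[R]_3 := \row_n (if n == j then s else if n == k then t else 0).
have eE s t : [/\ e s t 0 i = 0, e s t 0 j = s & e s t 0 k = t].
  by rewrite !mxE !eqxx (negbTE ij) (negbTE ik) (eq_sym k) (negbTE jk).
have [ui uj uk] := eE A B; have [vi vj vk] := eE A (- B).
have u0 : e A B != 0 by apply/eqP => /rowP/(_ j); rewrite uj mxE; lra.
have v0 : e A (- B) != 0 by apply/eqP => /rowP/(_ j); rewrite vj mxE; lra.
exists (e A B), (e A (- B)); split.
  split=> //; rewrite ?incident_axis_line ?ui ?vi //.
  apply/negP => /same_eltP[c _ /rowP ec].
  by move: (ec j) (ec k); rewrite !mxE_scale uj uk vj vk => ? ?; nra.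
apply/seteqP; split=> x /=.
  move=> [x0 xi xjk]; split=> //.
  pose s := x 0 j / (2 * A) + x 0 k / (2 * B).
  pose t := x 0 j / (2 * A) - x 0 k / (2 * B).
  have xE : x = s *: e A B + t *: e A (- B).
    apply/rowP => n; rewrite mxE_add !mxE_scale.
    case: (ord3_cases n) => ->; rewrite ?(ui, uj, uk, vi, vj, vk) ?xi; first by ring.
      by rewrite /s /t; field; rewrite !gt_eqF.
    by rewrite /s /t; field; rewrite !gt_eqF.
  have st : 0 <= s * t.
    have -> : s * t = (B * x 0 j - A * x 0 k) * (B * x 0 j + A * x 0 k) / (2 * A * B) ^+ 2.
      by rewrite /s /t; field; rewrite !gt_eqF.
    by rewrite divr_ge0 // sqr_ge0.
  have [[s0 t0]|[s0 t0]] : 0 <= s /\ 0 <= t \/ s <= 0 /\ t <= 0.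
    have [s0|s0] := leP 0 s; have [t0|t0] := leP 0 t; try by lra.
      by right; nra.
    by right; nra.
    by exists s, t; split=> //; apply/same_eltP; exists 1; rewrite ?oner_eq0 ?scale1r.
  exists (- s), (- t); split; rewrite ?oppr_ge0 //.
  apply/same_eltP; exists (-1); rewrite ?oppr_eq0 ?oner_eq0 //.
  by rewrite scaleN1r opprD -!scaleNr !opprK.
move=> [x0 [s [t [s0 t0 /same_eltP[c c0 /rowP xE]]]]]; split=> //.
  by rewrite xE mxE_scale mxE_add !mxE_scale ui vi; ring.
rewrite !xE !mxE_scale !mxE_add !mxE_scale uj uk vj vk.
have -> : (B * (c * (s * A + t * A)) - A * (c * (s * B + t * - B))) *
  (B * (c * (s * A + t * A)) + A * (c * (s * B + t * - B))) =
  (2 * A * B * c) ^+ 2 * (s * t) by ring.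
by rewrite mulr_ge0 ?sqr_ge0 ?mulr_ge0.
Qed.
End ThreeAxes.

End Segment.

(** * The Fregier locus as image of a conic under a diagonal map *)

Section Locus.
Variable R : realType.
Implicit Types (f p x : 'rV[R]_3) (M N : 'M[R]_3).

(** If both coefficients are positive, this is the whole line; if their signs differ, square roots
    factor the form as a difference of squares. *)
Lemma projective_segment_quadratic (i j k : 'I_3) (al be : R) :
  i != j -> i != k -> j != k -> al != 0 -> be != 0 -> ~ (al < 0 /\ be < 0) ->
  projective_segment (axis_line R i)
    [set f : 'rV[R]_3 | [/\ f != 0, f 0 i = 0 &
      0 <= al * f 0 j ^+ 2 + be * f 0 k ^+ 2]].
Proof.
move=> ij ik jk al0 be0 abn.
have [al_gt0|al_lt0|e] := ltrgtP 0 al; last by rewrite -e eqxx in al0.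
  have [be_gt0|be_lt0|e] := ltrgtP 0 be; last by rewrite -e eqxx in be0.
    left; apply/seteqP; split=> x /=; rewrite incident_axis_line.
      by case=> x0 -> _; rewrite eqxx.
    by case=> x0 /eqP xi; split=> //; apply: addr_ge0; apply: mulr_ge0; rewrite ?sqr_ge0 ?ltW.
  have al1 : Num.sqrt al ^+ 2 = al by rewrite sqr_sqrtr ?ltW.
  have be1 : Num.sqrt (- be) ^+ 2 = - be by rewrite sqr_sqrtr ?oppr_ge0 ?ltW.
  have := @projective_segment_hyperbolic R i j k ij ik jk (Num.sqrt (- be)) (Num.sqrt al).
  rewrite !sqrtr_gt0 oppr_gt0 => /(_ be_lt0 al_gt0); congr projective_segment.
  apply/seteqP; split=> x /= [x0 xi xjk]; split=> //; move: xjk;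
  by rewrite -subr_sqr !exprMn al1 be1 mulNr opprK.
have be_gt0 : 0 < be by have [|be_lt0|e] := ltrgtP 0 be => //; [case: abn | rewrite -e eqxx in be0].
have al1 : Num.sqrt (- al) ^+ 2 = - al by rewrite sqr_sqrtr ?oppr_ge0 ?ltW.
have be1 : Num.sqrt be ^+ 2 = be by rewrite sqr_sqrtr ?ltW.
have kj : k != j by rewrite eq_sym.
have := @projective_segment_hyperbolic R i k j ik ij kj (Num.sqrt (- al)) (Num.sqrt be).
rewrite !sqrtr_gt0 oppr_gt0 => /(_ al_lt0 be_gt0); congr projective_segment.
apply/seteqP; split=> x /= [x0 xi xjk]; split=> //; move: xjk;
by rewrite -subr_sqr !exprMn al1 be1 mulNr opprK addrC.
Qed.

Definition conic_image M T : set 'rV[R]_3 :=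
  [set f | exists2 p, conic_set M p & same_elt f (p *m T)].

Lemma fregier_locusE M N : M^T = M -> M \in unitmx -> N^T = N -> N \in unitmx ->
  (forall p, conic_set M p -> p *m fregier_mx M N != 0) ->
  fregier_locus N M = conic_image M (fregier_mx M N).
Proof.
move=> sM uM sN uN T0; apply/seteqP; split=> f /= [p].
  rewrite inE => pM Hf; exists p => //.
  by case: (pM) => p0 pc; apply: (is_fregier_pointP sM uM sN uN f p0 pc (T0 p pM)).1.
move=> pM Hf; exists p; first by rewrite inE.
by case: (pM) => p0 pc; apply: (is_fregier_pointP sM uM sN uN f p0 pc (T0 p pM)).2.
Qed.

(** The map forgets only p_i, while p_j = f_j / t_j and p_k = f_k / t_k. The conic equation then
    prescribes p_i^2 as a quadratic form in f_j, f_k, solvable over the reals when its value is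
    nonnegative. Indefiniteness of [c] keeps this form from being negative definite. *)
Lemma conic_image_diag_segment (c t : 'rV[R]_3) (i j k : 'I_3) :
  i != j -> i != k -> j != k -> (forall n, c 0 n != 0) ->
  ~ (0 < c 0 j / c 0 i /\ 0 < c 0 k / c 0 i) ->
  t 0 i = 0 -> t 0 j != 0 -> t 0 k != 0 ->
  projective_segment (axis_line R i) (conic_image (diag_mx c) (diag_mx t)).
Proof.
move=> ij ik jk c0 cpos ti tj tk.
have tj2 : 0 < t 0 j ^+ 2 by rewrite exprn_even_gt0.
have tk2 : 0 < t 0 k ^+ 2 by rewrite exprn_even_gt0.
pose al := - (c 0 j / c 0 i) / t 0 j ^+ 2.
pose be := - (c 0 k / c 0 i) / t 0 k ^+ 2.
have al0 : al != 0 by rewrite !(mulf_neq0, oppr_eq0, invr_eq0, expf_neq0).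
have be0 : be != 0 by rewrite !(mulf_neq0, oppr_eq0, invr_eq0, expf_neq0).
have abn : ~ (al < 0 /\ be < 0).
  by rewrite /al /be !pmulr_llt0 ?invr_gt0 // !oppr_lt0.
have := projective_segment_quadratic ij ik jk al0 be0 abn.
congr projective_segment; apply/seteqP; split=> f /=.
  move=> [f0 fi ab].
  pose p : 'rV[R]_3 := \row_n (if n == i then Num.sqrt (al * f 0 j ^+ 2 + be * f 0 k ^+ 2)
                   else f 0 n / t 0 n).
  have [pi pj pk] : [/\ p 0 i ^+ 2 = al * f 0 j ^+ 2 + be * f 0 k ^+ 2,
      p 0 j = f 0 j / t 0 j & p 0 k = f 0 k / t 0 k].
    by rewrite !mxE eqxx !(eq_sym _ i) (negbTE ij) (negbTE ik) sqr_sqrtr.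
  have fE : f = p *m diag_mx t.
    apply/rowP => n; rewrite mul_mx_diag mxE.
    by case: (ord3_cases ij ik jk n) => ->; rewrite ?ti ?pj ?pk ?mulr0 ?mulfVK.
  exists p; last by apply/same_eltP; exists 1; rewrite ?oner_eq0 ?scale1r.
  split; first by apply: contra_neq f0 => p0; rewrite fE p0 mul0mx.
  rewrite on_conic_diag (sum_three ij ik jk) pi pj pk /al /be; apply/eqP.
  by field; rewrite tj tk c0.
move=> [p [p0 pc] /same_eltP[s s0 fE]].
have fn n : f 0 n = s * (p 0 n * t 0 n) by rewrite fE mul_mx_diag !mxE.
have t_one m n : m != n -> t 0 m = 0 -> t 0 n != 0.
  case: (ord3_cases ij ik jk m) => -> mn tm; try by rewrite tm eqxx in tj tk.
  by case: (ord3_cases ij ik jk n) mn => -> //; rewrite eqxx.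
split.
- by rewrite fE scaler_eq0 negb_or s0 (mul_diag_conic_neq0 c0).
- by rewrite fn ti !mulr0.
have : c 0 i * p 0 i ^+ 2 + c 0 j * p 0 j ^+ 2 + c 0 k * p 0 k ^+ 2 = 0.
  by apply/eqP; rewrite -(sum_three ij ik jk (fun n => c 0 n * p 0 n ^+ 2)) -on_conic_diag.
move=> pc'; rewrite !fn /al /be.
have -> : - (c 0 j / c 0 i) / t 0 j ^+ 2 * (s * (p 0 j * t 0 j)) ^+ 2 +
    - (c 0 k / c 0 i) / t 0 k ^+ 2 * (s * (p 0 k * t 0 k)) ^+ 2 =
    (s * p 0 i) ^+ 2 - s ^+ 2 / c 0 i *
      (c 0 i * p 0 i ^+ 2 + c 0 j * p 0 j ^+ 2 + c 0 k * p 0 k ^+ 2).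
  by field; rewrite tj tk c0.
by rewrite pc' mulr0 subr0 sqr_ge0.
Qed.

(** The matrix of N is its own inverse, so M N^-1 has diagonal 1, b, a and trace 1 + a + b. *)
Lemma fregier_mx_axis_conic (a b : R) :
  fregier_mx (axis_conic b a) (axis_conic 1 1) =
  diag_mx (\row_(i < 3) [:: 1 - a - b; b - a - 1; a - b - 1]`_i).
Proof.
rewrite /fregier_mx; have -> : invmx (axis_conic 1 1) = axis_conic 1 1 :> 'M[R]_3.
  have NN : axis_conic 1 1 *m axis_conic 1 1 = 1%:M :> 'M[R]_3.
    rewrite mulmx_diag -diag_const_mx; congr diag_mx.
    by apply: rV3_eq; rewrite !mxE /=; ring.
  have uN : (axis_conic 1 1 : 'M[R]_3) \in unitmx by apply: axis_conic_unit; rewrite oner_eq0.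
  by rewrite -[LHS]mulmx1 -NN mulmxA mulVmx // mul1mx.
rewrite mulmx_diag mxtrace_diag sum_ord3 !mxE /=.
rewrite -diag_const_mx -linearZ -linearB; congr diag_mx.
by apply: rV3_eq; rewrite !mxE /=; ring.
Qed.

Lemma map_axis_conic (F F' : fieldType) (g : {rmorphism F -> F'}) (c1 c2 : F) :
  map_mx g (axis_conic c1 c2) = axis_conic (g c1) (g c2).
Proof.
rewrite map_diag_mx; congr diag_mx.
by apply: rV3_eq; rewrite !mxE //= rmorphN1.
Qed.

(** Translates the three singularity conditions into the vanishing of an entry of T. If a
    denominator is zero, its quotient is 0 by convention and both sides are false, since a is
    nonzero. *)
Lemma eq_inv_div (a b : R) : a != 0 -> b != 0 ->
  [/\ (a^-1 == b^-1 / (b^-1 + 1)) = (a - b - 1 == 0),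
      (a^-1 == - b^-1 / (b^-1 - 1)) = (b - a - 1 == 0) &
      (a^-1 == b^-1 / (b^-1 - 1)) = (1 - a - b == 0)].
Proof.
move=> a0 b0.
have e1 : b^-1 / (b^-1 + 1) = (b + 1)^-1.
  have -> : b^-1 + 1 = (b + 1) / b by field.
  by rewrite invfM invrK mulrCA mulVf ?mulr1.
have e2 : b^-1 / (b^-1 - 1) = (1 - b)^-1.
  have -> : b^-1 - 1 = (1 - b) / b by field.
  by rewrite invfM invrK mulrCA mulVf ?mulr1.
rewrite mulNr e1 e2 -invrN !(inj_eq invr_inj).
by split; [|rewrite -[RHS]oppr_eq0|rewrite -[RHS]oppr_eq0];
  rewrite -subr_eq0; congr (_ == 0); ring.
Qed.

End Locus.

Unset Implicit Arguments.

(* C is b x1^2 + a x2^2 = x0^2, that is x1^2 / a2 + x2^2 / b2 = x0^2. The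
   formulas for the Fregier conic hold in terms of the (signed) squares
   a2 = 1 / b and b2 = 1 / a of the semi-axes, written a^2 and b^2 in the source;
   with a^2 and b^2 read as squares of the coefficients they would be false. *)
Theorem mainTheorem4 (R : realType) (a b : R)
  (ha : a != 0) (hb : b != 0)
  (hneg : ~ (a < 0 /\ b < 0)) (hone : ~ (a = 1 /\ b = 1)) :
  let N := axis_conic 1 1 in
  let C := axis_conic b a in
  let a2 := b^-1 in
  let b2 := a^-1 in
  let L := fregier_locus N C in
  let F := conic_set (axis_conic
    ((a2 * b2 - a2 - b2) ^+ 2 / ((a2 * b2 + a2 - b2) ^+ 2 * a2))
    ((a2 * b2 - a2 - b2) ^+ 2 / ((a2 * b2 - a2 + b2) ^+ 2 * b2))) in
  [/\ (a = 1 /\ b <> 1) \/ (b = 1 /\ a <> 1) -> is_circle N C,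
      a2 * b2 + a2 - b2 != 0 -> a2 * b2 - a2 + b2 != 0 ->
        L `<=` F /\ (is_conic L -> L = F),
      is_singular L <->
        [\/ b2 = a2 / (a2 + 1), b2 = - a2 / (a2 - 1) | b2 = a2 / (a2 - 1)] &
      [/\ b2 = a2 / (a2 + 1) -> projective_segment (axis_line R 2) L,
          b2 = - a2 / (a2 - 1) -> projective_segment (axis_line R 1) L &
          b2 = a2 / (a2 - 1) -> projective_segment (axis_line R 0) L]].
Proof.
move=> N C a2 b2 L F.
pose c : 'rV[R]_3 := \row_(i < 3) [:: -1; b; a]`_i.
pose t : 'rV[R]_3 := \row_(i < 3) [:: 1 - a - b; b - a - 1; a - b - 1]`_i.
have [e2 e1 e0] := eq_inv_div ha hb.
have c0 n : c 0 n != 0.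
  by rewrite mxE; case: n => [[|[|[|//]]] ?] /=; rewrite ?oppr_eq0 ?oner_eq0.
(* The pairwise sums of the entries are -2a, -2b and -2, all nonzero. *)
have t_one m n : m != n -> t 0 m = 0 -> t 0 n != 0.
  rewrite !mxE => mn tm; apply/eqP; move: mn tm.
  case: m => [[|[|[|//]]] ?]; case: n => [[|[|[|//]]] ?] //= _ tm tn;
    by (case/eqP: ha; lra) || (case/eqP: hb; lra) || lra.
have uC : C \in unitmx by apply: axis_conic_unit.
have uN : N \in unitmx by apply: axis_conic_unit; rewrite oner_eq0.
have LE : L = conic_image C (diag_mx t).
  rewrite /L fregier_locusE ?tr_axis_conic // fregier_mx_axis_conic // => p [p0 pC].
  exact: (mul_diag_conic_neq0 c0 t_one).
have seg i j k : i != j -> i != k -> j != k ->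
    ~ (0 < c 0 j / c 0 i /\ 0 < c 0 k / c 0 i) -> t 0 i = 0 ->
    projective_segment (axis_line R i) L.
  move=> ij ik jk cn ti; rewrite LE.
  by apply: (conic_image_diag_segment ij ik jk c0 cn) => //; apply: t_one ti.
have ab_pos : 0 < a \/ 0 < b.
  have [|a_lt0|e] := ltrgtP 0 a; [by left| |by rewrite -e eqxx in ha].
  have [|b_lt0|e] := ltrgtP 0 b; [by right|by case: hneg|by rewrite -e eqxx in hb].
have seg0 : t 0 0 = 0 -> projective_segment (axis_line R 0) L.
  apply: (seg 0 1 2) => //; rewrite !mxE /= invrN1 !mulrN1 !oppr_gt0 => -[].
  by case: ab_pos; lra.
have seg1 : t 0 1 = 0 -> projective_segment (axis_line R 1) L.
  apply: (seg 1 0 2) => //; rewrite !mxE /= mulN1r oppr_gt0 invr_lt0 => -[b_lt0].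
  by rewrite nmulr_lgt0 ?invr_lt0 // => a_lt0; case: hneg.
have seg2 : t 0 2 = 0 -> projective_segment (axis_line R 2) L.
  apply: (seg 2 0 1) => //; rewrite !mxE /= mulN1r oppr_gt0 invr_lt0 => -[a_lt0].
  by rewrite nmulr_lgt0 ?invr_lt0 // => b_lt0; case: hneg.
have D0 : a2 * b2 - a2 - b2 = (1 - a - b) / (a * b) by rewrite /a2 /b2; field; rewrite ?ha ?hb.
have D1 : a2 * b2 + a2 - b2 = - (b - a - 1) / (a * b) by rewrite /a2 /b2; field; rewrite ?ha ?hb.
have D2 : a2 * b2 - a2 + b2 = - (a - b - 1) / (a * b) by rewrite /a2 /b2; field; rewrite ?ha ?hb.
have nz (s : R) : (- s / (a * b) != 0) = (s != 0).
  by rewrite mulf_eq0 invr_eq0 mulf_eq0 (negbTE ha) (negbTE hb) !orbF oppr_eq0.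
have [t0E t1E t2E] : [/\ t 0 0 = 1 - a - b, t 0 1 = b - a - 1 & t 0 2 = a - b - 1].
  by rewrite !mxE.
clearbody t.
have axis0 i : axis_line R i != 0.
  apply/eqP => /rowP/(_ i)/eqP; rewrite !mxE !eqxx oner_eq0 //.
(* These coefficients arise by substituting p_n = f_n / t_n into the equation of C and clearing t_0;
   the result makes sense also for t_0 = 0. *)
have FE : t 0 1 != 0 -> t 0 2 != 0 ->
    F = conic_set (axis_conic (b * (t 0 0 / t 0 1) ^+ 2) (a * (t 0 0 / t 0 2) ^+ 2)).
  move=> t1 t2; rewrite /F D0 D1 D2 -t0E -t1E -t2E /a2 /b2.
  have coef x y (d : R) : y != 0 -> d != 0 ->
      (x / (a * b)) ^+ 2 / ((- y / (a * b)) ^+ 2 * d^-1) = d * (x / y) ^+ 2.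
    by move=> y0 d0; field; rewrite ha hb y0 d0.
  by rewrite !coef.
clearbody L F.
have LF : t 0 1 != 0 -> t 0 2 != 0 -> L `<=` F.
  move=> t1 t2; rewrite LE (FE t1 t2) => f [p [p0 pC] /same_eltP[k k0 fE]].
  have fn n : f 0 n = k * (p 0 n * t 0 n) by rewrite fE mul_mx_diag !mxE.
  split; first by rewrite fE scaler_eq0 negb_or k0 (mul_diag_conic_neq0 c0 t_one).
  move: pC; rewrite !on_axis_conic !fn => /eqP pC; apply/eqP.
  by rewrite !(exprMn, exprVn) -pC; field; rewrite t1 t2.
have FL : t 0 0 != 0 -> t 0 1 != 0 -> t 0 2 != 0 -> F `<=` L.
  move=> t00 t1 t2; rewrite LE (FE t1 t2) => f [f0 fF].
  have tn n : t 0 n != 0.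
    by case: (@ord3_cases 0 1 2 isT isT isT n) => ->.
  pose p : 'rV[R]_3 := \row_n (f 0 n / t 0 n).
  have pn n : p 0 n = f 0 n / t 0 n by rewrite mxE.
  have fE : f = p *m diag_mx t.
    by apply/rowP => n; rewrite mul_mx_diag mxE pn mulfVK.
  exists p; last by apply/same_eltP; exists 1; rewrite ?oner_eq0 ?scale1r.
  split; first by apply: contra_neq f0 => p0; rewrite fE p0 mul0mx.
  move: fF; rewrite !on_axis_conic !pn => /eqP fF; apply/eqP.
  by rewrite [RHS]expr_div_n -fF; field; rewrite t00 t1 t2.
split.
- move=> ab1; split=> //; first exact: tr_axis_conic.
    move=> k /matrixP CN; move: (CN 0 0) (CN 1 1) (CN 2 2).
    by rewrite !mxE /= !mulr1n => ? ? ?; case: hone; split; lra.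
  rewrite !map_axis_conic rmorph1; apply: double_contact_axis_conic.
    by rewrite pnatr_eq0.
  by case: ab1 => -[-> _]; [right|left]; rewrite rmorph1.
- rewrite D1 D2 !nz -t1E -t2E => t1 t2; split; first exact: LF.
  (* If t_0 = 0, then F is the double line x_0 = 0, and L, a segment of that line and a conic, must
     be all of it. *)
  have [t00|t00] := eqVneq (t 0 0) 0; last first.
    by move=> _; apply/seteqP; split; [exact: LF|exact: FL].
  move=> cL; apply/seteqP; split; first exact: LF.
  apply: subset_trans (projective_segment_is_conic (axis0 0) (seg0 t00) cL).
  rewrite (FE t1 t2) => f [f0 fF]; split=> //; move: fF; rewrite incident_axis_line.
  by rewrite on_axis_conic t00 !mul0r expr0n /= !mulr0 !mul0r addr0 eq_sym expf_eq0.
- split=> [sL|].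
    have [t00|t00] := eqVneq (t 0 0) 0.
      by apply/Or33/eqP; rewrite e0 -t0E t00.
    have [t1|t1] := eqVneq (t 0 1) 0.
      by apply/Or32/eqP; rewrite e1 -t1E t1.
    have [t2|t2] := eqVneq (t 0 2) 0.
      by apply/Or31/eqP; rewrite e2 -t2E t2.
    (* With no zero entry in T, L is F, whose coefficients are then nonzero, so it is regular. *)
    case: sL; have -> : L = F by apply/seteqP; split; [exact: LF|exact: FL].
    rewrite (FE t1 t2); apply: axis_conic_regular.
      by rewrite mulf_neq0 ?expf_neq0 ?mulf_neq0 ?invr_eq0.
    by rewrite mulf_neq0 ?expf_neq0 ?mulf_neq0 ?invr_eq0.
  case=> /eqP; rewrite ?e0 ?e1 ?e2 -?t0E -?t1E -?t2E => /eqP tz.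
  + exact: projective_segment_singular (axis0 2) (seg2 tz).
  + exact: projective_segment_singular (axis0 1) (seg1 tz).
  + exact: projective_segment_singular (axis0 0) (seg0 tz).
- split=> /eqP; rewrite ?e0 ?e1 ?e2 -?t0E -?t1E -?t2E => /eqP.
  + exact: seg2.
  + exact: seg1.
  + exact: seg0.
Qed.
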